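(* Let $X$ be a Banach space, $F$ a Banach lattice, and $T:X\to F$ a bounded linear operator. Then $T$ is limitedly L-weakly compact if and only if for every disjoint norm-bounded sequence $(f_n)$ in the dual $F'$ one has $T'f_n\to 0$ in the weak$^\ast$ topology of $X'$ (i.e. $f_n(Tx)\to 0$ for every $x\in X$).
   Context: All vector spaces are real and operators are linear and bounded; $T'$ denotes the adjoint of $T$. For a subset $A$ of a Banach lattice $F$, $\mathrm{sol}(A)=\bigcup_{a\in A}[-|a|,|a|]$ is its solid hull. A subset $A\subseteq F$ is an Lwc-set if every disjoint sequence in $\mathrm{sol}(A)$ is norm-null. A bounded subset $A$ of a Banach space $X$ is limited if every weak$^\ast$-null sequence $(g_n)$ in $X'$ converges to $0$ uniformly on $A$, i.e. $\sup_{a\in A}|g_n(a)|\to 0$. An operator $T:X\to F$ is limitedly L-weakly compact if $T$ maps every limited subset of $X$ onto an Lwc-subset of $F$. A sequence $(f_n)$ in $F'$ is disjoint if $|f_n|\wedge|f_m|=0$ for $n\ne m$. *)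

(* Defs.v *)
From HB Require Import structures.
From mathcomp Require Import all_boot all_order all_algebra.
From mathcomp Require Import all_classical all_reals all_analysis.
Set Implicit Arguments. Unset Strict Implicit. Unset Printing Implicit Defensive.
Import Order.TTheory GRing.Theory Num.Theory.
Import numFieldNormedType.Exports.
Local Open Scope classical_set_scope.
Local Open Scope ring_scope.

Section BL.
Variables (R : realType) (F : normedModType R).
Variables (le : F -> F -> Prop) (join : F -> F -> F).

Definition labs (x : F) : F := join x (- x).
Definition lmeet (x y : F) : F := - join (- x) (- y).

(* A normed Riesz space (vector lattice with a lattice norm), order given by
   [le], supremum by [join]. Completeness is imposed via the type of F. *)
Record is_banach_lattice : Prop := {
  bl_refl : forall x, le x x;
  bl_trans : forall x y z, le x y -> le y z -> le x z;
  bl_anti : forall x y, le x y -> le y x -> x = y;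
  bl_add : forall x y z, le x y -> le (x + z) (y + z);
  bl_scale : forall (a : R) x y, 0 <= a -> le x y -> le (a *: x) (a *: y);
  bl_join_l : forall x y, le x (join x y);
  bl_join_r : forall x y, le y (join x y);
  bl_join_lub : forall x y z, le x z -> le y z -> le (join x y) z;
  bl_norm : forall x y, le (labs x) (labs y) -> `|x| <= `|y|
}.

Definition solid_hull (A : set F) : set F :=
  [set y | exists2 a, A a & le (- labs a) y /\ le y (labs a)].

Definition disjoint_seq (u : nat -> F) : Prop :=
  forall n m, n <> m -> lmeet (labs (u n)) (labs (u m)) = 0.

Definition Lwc_set (A : set F) : Prop :=
  forall u : nat -> F, (forall n, solid_hull A (u n)) -> disjoint_seq u ->
    u @ \oo --> (0 : F).

(* Order dual F': modulus of a functional via Riesz--Kantorovich: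
   |f|(x) = sup { |f y| : |y| <= x }  for x >= 0 *)
Definition dual_mod (f : F -> R) (x : F) : R :=
  sup [set `|f y| | y in [set y | le (labs y) x]].

Definition dual_meet_mod (f g : F -> R) (x : F) : R :=
  inf [set dual_mod f y + dual_mod g (x - y) | y in [set y | le 0 y /\ le y x]].

Definition dual_disjoint_seq (f : nat -> F -> R) : Prop :=
  forall n m, n <> m -> forall x, le 0 x -> dual_meet_mod (f n) (f m) x = 0.

End BL.

Definition is_lin (R : realType) (V : lmodType R) (f : V -> R) : Prop :=
  forall (a : R) (x y : V), f (a *: x + y) = a * f x + f y.

Definition is_dual (R : realType) (V : normedModType R) (f : V -> R) : Prop :=
  is_lin f /\ continuous f.

Definition dual_seq_bounded (R : realType) (V : normedModType R)
  (f : nat -> V -> R) : Prop :=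
  exists M : R, forall n x, `|f n x| <= M * `|x|.

Definition limited_set (R : realType) (X : normedModType R) (A : set X) : Prop :=
  (exists M : R, forall a, A a -> `|a| <= M) /\
  forall g : nat -> X -> R, (forall n, is_dual (g n)) ->
    (forall x, (fun n => g n x) @ \oo --> (0 : R)) ->
    forall eps : R, 0 < eps -> \forall n \near \oo, forall a, A a -> `|g n a| <= eps.

Definition limitedly_Lwc (R : realType) (X F : normedModType R)
  (le : F -> F -> Prop) (join : F -> F -> F) (T : X -> F) : Prop :=
  forall A : set X, limited_set A -> Lwc_set le join (T @` A).

(* Main.v *)
Require Import Defs.
From HB Require Import structures.
From mathcomp Require Import all_boot all_order all_algebra.
From mathcomp Require Import all_classical all_reals all_analysis.
From mathcomp Require Import ring lra.
Set Implicit Arguments. Unset Strict Implicit. Unset Printing Implicit Defensive.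
Import Order.TTheory GRing.Theory Num.Theory.
Import numFieldNormedType.Exports.
Local Open Scope classical_set_scope.
Local Open Scope ring_scope.

(** Necessity. Singletons are limited, so every disjoint sequence in [[0, y]],
    [y = |T x|], is norm-null. Then monotone sequences in [[0, y]] converge: if
    [u_k >= 0] has partial sums below [y], at most [1/d] of the elements
    [u_k - d y] can be simultaneously positive, and an induction on this
    multiplicity, with a disjointification at each step, gives [u_k -> 0]. For
    disjoint [f_n] choose [z_n] in [[0, y]] with [|f_n|(y - z_n) <= 2^-n] and
    [|f_m|(z_n) <= 2^-n] for [m < n]. The suprema [w_n] of the tails of [z]
    decrease to some [w] with [|f_m|(w) = 0] for all [m], so that
    [|f_n|(y) <= |f_n|(w_n - w) + 2^-n -> 0].

    Sufficiency. Let [u_n] be disjoint with [|u_n| <= |T a_n|], [a_n] in a limited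
    set. With [phi_n >= 0] norming [|u_n|], the seminorms
    [p_n x = sup_k phi_n (|x| /\ k |u_n|)] are pairwise disjoint, and Hahn-Banach
    yields [h_n <= p_n] with [h_n (T a_n) = p_n (T a_n) >= ||u_n||]. The [h_n] are
    disjoint and bounded, hence [T' h_n] is weak*-null, hence uniformly small on
    the limited set. *)

(** * A normalisation tactic for identities in modules *)

Inductive mexpr (R : Type) : Type :=
  | MVar of nat | MZero | MAdd of mexpr R & mexpr R | MOpp of mexpr R
  | MScale of R & mexpr R.
Arguments MVar {R}. Arguments MZero {R}. Arguments MAdd {R}.
Arguments MOpp {R}. Arguments MScale {R}.

Fixpoint meval {R : comNzRingType} {V : lmodType R} (env : seq V) (e : mexpr R) : V :=
  match e with
  | MVar n => nth 0 env n
  | MZero => 0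
  | MAdd a b => meval env a + meval env b
  | MOpp a => - meval env a
  | MScale k a => k *: meval env a
  end.

Fixpoint mcoef {R : comNzRingType} (i : nat) (e : mexpr R) : R :=
  match e with
  | MVar n => if eqn n i then 1 else 0
  | MZero => 0
  | MAdd a b => mcoef i a + mcoef i b
  | MOpp a => - mcoef i a
  | MScale k a => k * mcoef i a
  end.

Lemma mevalE (R : comNzRingType) (V : lmodType R) (env : seq V) (e : mexpr R) :
  meval env e = \sum_(i < size env) mcoef i e *: nth 0 env i.
Proof.
elim: e => [n||a IHa b IHb|a IHa|k a IHa] /=.
- have [ltn|len] := ltnP n (size env).
    rewrite (bigD1 (Ordinal ltn)) //= (_ : eqn n n) ?scale1r; last by rewrite eqnE.
    rewrite big1 ?addr0 // => i; rewrite -val_eqE /= eq_sym => ni.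
    by rewrite eqnE (negbTE ni) scale0r.
  (* A variable outside [env] evaluates to the default 0, and no index of the sum matches it. *)
  rewrite nth_default // big1 // => i _; rewrite eqnE gtn_eqF ?scale0r //.
  exact: leq_trans (ltn_ord i) len.
- by rewrite big1 // => i _; rewrite scale0r.
- by rewrite IHa IHb -big_split /=; apply: eq_bigr => i _; rewrite scalerDl.
- by rewrite IHa -sumrN; apply: eq_bigr => i _; rewrite scaleNr.
- by rewrite IHa scaler_sumr; apply: eq_bigr => i _; rewrite scalerA.
Qed.

(** Recursive rather than quantified over indices, so that on a concrete environment it unfolds into
    one scalar equation per atom. *)
Fixpoint mcoef_eq {R : comNzRingType} (n : nat) (a b : mexpr R) : Prop :=
  if n is m.+1 then mcoef m a = mcoef m b /\ mcoef_eq m a b else True.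

Lemma meval_eq (R : comNzRingType) (V : lmodType R) (env : seq V) (a b : mexpr R) :
  mcoef_eq (size env) a b -> meval env a = meval env b.
Proof.
move=> H; rewrite !mevalE; apply: eq_bigr => i _; congr (_ *: _).
move: (size env) H i; elim=> [_ []//|n IHn [Hn H] i].
have [->//|ni] := eqVneq (i : nat) n.
have lin : (i < n)%N by have := ltn_ord i; rewrite ltnS leq_eqVlt (negbTE ni).
exact: IHn H (Ordinal lin).
Qed.

(* Equal sums may differ by the path along which the additive structure was
   inferred, so they are compared up to conversion. *)
Ltac same_atom x y :=
  first [constr_eq x y |
         lazymatch x with @bigop.body _ _ _ _ _ =>
         lazymatch y with @bigop.body _ _ _ _ _ => unify x y end end].
Ltac menv_add x env :=
  match env with
  | @nil ?T => constr:(@cons T x (@nil T))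
  | ?y :: _ => let _ := match goal with _ => same_atom x y end in env
  | ?y :: ?t => let t' := menv_add x t in constr:(y :: t')
  end.
Ltac menv t env :=
  lazymatch t with
  | @GRing.add _ ?a ?b => let env := menv a env in menv b env
  | @GRing.opp _ ?a => menv a env
  | @GRing.zero _ => env
  | @GRing.scale _ _ _ ?a => menv a env
  | _ => menv_add t env
  end.
Ltac mindex x env :=
  match env with
  | ?y :: _ => let _ := match goal with _ => same_atom x y end in constr:(0%N)
  | _ :: ?t => let n := mindex x t in constr:(S n)
  end.
Ltac mreify R t env :=
  lazymatch t with
  | @GRing.add _ ?a ?b =>
      let a' := mreify R a env in let b' := mreify R b env in
      constr:(@MAdd R a' b')
  | @GRing.opp _ ?a => let a' := mreify R a env in constr:(@MOpp R a')
  | @GRing.zero _ => constr:(@MZero R)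
  | @GRing.scale _ _ ?k ?a => let a' := mreify R a env in constr:(@MScale R k a')
  | _ => let n := mindex t env in constr:(@MVar R n)
  end.
(* [msolve R V] proves an equation in the [R]-module [V] by comparing the
   coefficients of the atoms on both sides with [ring] (or [field]). *)
Ltac msolve R V :=
  lazymatch goal with
  | |- @eq _ ?l ?r =>
    let env := menv l (@nil (GRing.Lmodule.sort V)) in
    let env := menv r env in
    let l' := mreify R l env in
    let r' := mreify R r env in
    apply: (@meval_eq R V env l' r'); rewrite /=;
    repeat lazymatch goal with |- _ /\ _ => split | |- True => exact I end;
    first [ring | by field]
  end.


(** * Riesz spaces with a lattice norm *)

Definition pospart {R : realType} {F : normedModType R} (join : F -> F -> F) (x : F) : F :=
  join x 0.

Section Riesz.
Variables (R : realType) (F : normedModType R).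
Variables (le : F -> F -> Prop) (join : F -> F -> F).
Hypothesis HF : is_banach_lattice le join.

Local Notation labs := (labs join).
Local Notation lmeet := (lmeet join).
Local Notation pos := (pospart join).

Lemma vle_subr_ge0 (x y : F) : le x y <-> le 0 (y - x).
Proof.
split=> [/(bl_add HF (- x))|/(bl_add HF x)]; first by rewrite subrr.
by rewrite add0r subrK.
Qed.

Lemma vle_addr_ge0 (x y : F) : le 0 x -> le 0 y -> le 0 (x + y).
Proof.
by move=> x0 /(bl_add HF x); rewrite add0r addrC; exact: (bl_trans HF).
Qed.

Lemma vle_scale_ge0 (a : R) (x : F) : 0 <= a -> le 0 x -> le 0 (a *: x).
Proof. by move=> a0 /(bl_scale HF a0); rewrite scaler0. Qed.

(** Linear certificates: an inequality follows from others once its gap is the sum of their gaps, an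
    identity left to [msolve]. *)
Lemma vle_lin1 (a b x y : F) : le a b -> y - x = b - a -> le x y.
Proof. by move=> /vle_subr_ge0 ab e; apply/vle_subr_ge0; rewrite e. Qed.

Lemma vle_lin2 (a b c d x y : F) :
  le a b -> le c d -> y - x = (b - a) + (d - c) -> le x y.
Proof.
move=> /vle_subr_ge0 ab /vle_subr_ge0 cd e; apply/vle_subr_ge0.
by rewrite e; exact: vle_addr_ge0.
Qed.

Lemma vle_lin3 (a b c d e f x y : F) : le a b -> le c d -> le e f ->
  y - x = (b - a) + (d - c) + (f - e) -> le x y.
Proof.
move=> ab cd /vle_subr_ge0 ef h.
apply: (@vle_lin2 0 ((b - a) + (d - c)) 0 (f - e)) => //; last by rewrite !subr0.
by apply: vle_addr_ge0; exact: (vle_subr_ge0 _ _).1.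
Qed.

Lemma vle_add (a b c d : F) : le a b -> le c d -> le (a + c) (b + d).
Proof. by move=> ab cd; apply: (vle_lin2 ab cd); msolve R F. Qed.

Lemma vle_opp (a b : F) : le a b -> le (- b) (- a).
Proof. by move=> ab; apply: (vle_lin1 ab); msolve R F. Qed.

Lemma vle_scale_le (a b : R) (x : F) : a <= b -> le 0 x -> le (a *: x) (b *: x).
Proof.
move=> ab x0; apply: (@vle_lin1 0 ((b - a) *: x)); last by msolve R F.
by apply: vle_scale_ge0; rewrite ?subr_ge0.
Qed.

Lemma vle_scale_le0 (a : R) (x : F) : 0 < a -> le (a *: x) 0 -> le x 0.
Proof.
move=> a0 /(bl_scale HF (ltW (_ : 0 < a^-1))); rewrite invr_gt0 => /(_ a0).
by rewrite scalerA mulVf ?gt_eqF // scale1r scaler0.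
Qed.

Lemma pos_ge0 (x : F) : le 0 (pos x). Proof. exact: (bl_join_r HF). Qed.

Lemma pos_ge (x : F) : le x (pos x). Proof. exact: (bl_join_l HF). Qed.

Lemma pos_lub (x z : F) : le x z -> le 0 z -> le (pos x) z.
Proof. exact: (bl_join_lub HF). Qed.

Lemma pos_mono (x y : F) : le x y -> le (pos x) (pos y).
Proof.
move=> xy; apply: pos_lub (pos_ge0 _).
exact: (bl_trans HF xy (pos_ge _)).
Qed.

Lemma pos_le0 (x : F) : le x 0 -> pos x = 0.
Proof.
by move=> x0; apply: (bl_anti HF) (pos_ge0 x); apply: pos_lub => //; exact: (bl_refl HF).
Qed.

(** If z lies below both parts, then q - z still dominates -x and 0, so leastness of q = (-x)^+
    gives q <= q - z. *)
Lemma pos_disjoint (x z : F) : le z (pos x) -> le z (pos (- x)) -> le z 0.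
Proof.
set q := pos (- x) => zx zq.
have xq : le (pos x) (x + q).
  apply: pos_lub; first by apply: (vle_lin1 (pos_ge0 (- x))); rewrite -/q; msolve R F.
  by apply: (vle_lin1 (pos_ge (- x))); rewrite -/q; msolve R F.
have : le q (q - z).
  apply: pos_lub; last by apply: (vle_lin1 zq); msolve R F.
  by apply: (vle_lin2 zx xq); msolve R F.
by move=> h; apply: (vle_lin1 h); msolve R F.
Qed.

Lemma labs_ge (x : F) : le x (labs x). Proof. exact: (bl_join_l HF). Qed.

Lemma labs_geN (x : F) : le (- x) (labs x). Proof. exact: (bl_join_r HF). Qed.

Lemma labs_lub (x z : F) : le x z -> le (- x) z -> le (labs x) z.
Proof. exact: (bl_join_lub HF). Qed.

(** Half the sum of x <= |x| and -x <= |x|. *)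
Lemma labs_ge0 (x : F) : le 0 (labs x).
Proof.
have h : le 0 (2^-1 *: (labs x + labs x)).
  apply: vle_scale_ge0; first by rewrite invr_ge0.
  by apply: (vle_lin2 (labs_ge x) (labs_geN x)); msolve R F.
by apply: (vle_lin1 h); msolve R F.
Qed.

Lemma ge0_labs (x : F) : le 0 x -> labs x = x.
Proof.
move=> x0; apply: (bl_anti HF) (labs_ge x); apply: labs_lub; first exact: (bl_refl HF).
by apply: (vle_lin2 x0 x0); msolve R F.
Qed.

Lemma labsN (x : F) : labs (- x) = labs x.
Proof.
by apply: (bl_anti HF); apply: labs_lub; rewrite ?opprK;
  first [exact: labs_ge | exact: labs_geN | rewrite -{1}(opprK x); exact: labs_geN].
Qed.

Lemma labs_le (x z : F) : le (labs x) z -> le x z /\ le (- z) x.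
Proof.
move=> xz; split; first exact: (bl_trans HF (labs_ge x) xz).
by apply: (vle_lin2 (labs_geN x) xz); msolve R F.
Qed.

Lemma labs_leP (x z : F) : le (- z) x -> le x z -> le (labs x) z.
Proof.
by move=> zx xz; apply: labs_lub => //; apply: (vle_lin1 zx); msolve R F.
Qed.

Lemma labsD (x y : F) : le (labs (x + y)) (labs x + labs y).
Proof.
apply: labs_lub; first exact: vle_add (labs_ge _) (labs_ge _).
by rewrite opprD; exact: vle_add (labs_geN _) (labs_geN _).
Qed.

Lemma labsZ (a : R) (x : F) : 0 <= a -> le (labs (a *: x)) (a *: labs x).
Proof.
move=> a0; apply: labs_lub; first exact: (bl_scale HF a0 (labs_ge x)).
by rewrite -scalerN; exact: (bl_scale HF a0 (labs_geN x)).
Qed.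

Lemma norm_labs (x : F) : `|labs x| = `|x|.
Proof.
apply/eqP; rewrite eq_le; apply/andP; split; apply: (bl_norm HF).
  by rewrite (ge0_labs (labs_ge0 x)); exact: (bl_refl HF).
by rewrite (ge0_labs (labs_ge0 x)); exact: (bl_refl HF).
Qed.

Lemma norm_labs_le (x y : F) : le (labs x) y -> `|x| <= `|y|.
Proof.
move=> xy; apply: (bl_norm HF); apply: (bl_trans HF xy); exact: labs_ge.
Qed.

Lemma norm_le (x y : F) : le 0 x -> le x y -> `|x| <= `|y|.
Proof. by move=> x0 xy; apply: norm_labs_le; rewrite ge0_labs. Qed.

Lemma norm_pos_le (x : F) : `|pos x| <= `|x|.
Proof.
rewrite -(norm_labs x); apply: norm_le; first exact: pos_ge0.
by apply: pos_lub; [exact: labs_ge | exact: labs_ge0].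
Qed.

Lemma lmeet_lel (x y : F) : le (lmeet x y) x.
Proof.
by apply: (vle_lin1 (bl_join_l HF (- x) (- y))); rewrite /lmeet; msolve R F.
Qed.

Lemma lmeet_ler (x y : F) : le (lmeet x y) y.
Proof.
by apply: (vle_lin1 (bl_join_r HF (- x) (- y))); rewrite /lmeet; msolve R F.
Qed.

Lemma lmeet_glb (x y z : F) : le z x -> le z y -> le z (lmeet x y).
Proof.
move=> zx zy; have h := bl_join_lub HF (vle_opp zx) (vle_opp zy).
by apply: (vle_lin1 h); rewrite /lmeet; msolve R F.
Qed.

Lemma lmeetC (x y : F) : lmeet x y = lmeet y x.
Proof.
by apply: (bl_anti HF); apply: lmeet_glb; first [exact: lmeet_lel | exact: lmeet_ler].
Qed.

Lemma lmeet_mono (x x' y y' : F) : le x x' -> le y y' -> le (lmeet x y) (lmeet x' y').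
Proof.
move=> xx yy; apply: lmeet_glb; first exact: (bl_trans HF (lmeet_lel _ _) xx).
exact: (bl_trans HF (lmeet_ler _ _) yy).
Qed.

(** With w the left-hand side, w - y lies below the first meet on the right; subtracting that meet
    from w then leaves something below the second. *)
Lemma lmeet_addl (x y u : F) : le 0 x -> le 0 y -> le 0 u ->
  le (lmeet (x + y) u) (lmeet x u + lmeet y u).
Proof.
move=> x0 y0 u0; set w := lmeet (x + y) u.
have wxy : le w (x + y) by exact: lmeet_lel.
have wu : le w u by exact: lmeet_ler.
have xu0 : le 0 (lmeet x u) by exact: lmeet_glb.
have h1 : le (w - y) (lmeet x u).
  apply: lmeet_glb; first by apply: (vle_lin1 wxy); msolve R F.
  by apply: (vle_lin2 wu y0); msolve R F.
have h2 : le (w - lmeet x u) (lmeet y u).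
  apply: lmeet_glb; first by apply: (vle_lin1 h1); msolve R F.
  by apply: (vle_lin2 wu xu0); msolve R F.
by apply: (vle_lin1 h2); msolve R F.
Qed.

Lemma lmeetZ (a b : R) (x y : F) : 0 <= a -> 0 <= b -> le 0 x -> le 0 y ->
  lmeet x y = 0 -> lmeet (a *: x) (b *: y) = 0.
Proof.
move=> a0 b0 x0 y0 xy; apply: (bl_anti HF); last first.
  by apply: lmeet_glb; exact: vle_scale_ge0.
(* This constant dominates [a] and [b], and the added 1 keeps it invertible when both vanish.
   Dividing by it puts the scaled meet below [lmeet x y]. *)
have c0 : 0 < Num.max a b + 1 by rewrite ltr_wpDl // le_max a0.
set c := Num.max a b + 1 in c0.
have ac : a <= c by rewrite /c ler_wpDr // le_max lexx.
have bc : b <= c by rewrite /c ler_wpDr // le_max lexx orbT.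
have cV : 0 <= c^-1 by rewrite invr_ge0 ltW.
apply: (vle_scale_le0 (a := c^-1)); first by rewrite invr_gt0.
rewrite -xy; apply: lmeet_glb.
  apply: (bl_trans HF (bl_scale HF cV (lmeet_lel _ _))) _.
  rewrite scalerA -[X in le _ X]scale1r; apply: vle_scale_le => //.
  by rewrite mulrC ler_pdivrMr // mul1r.
apply: (bl_trans HF (bl_scale HF cV (lmeet_ler _ _))) _.
rewrite scalerA -[X in le _ X]scale1r; apply: vle_scale_le => //.
by rewrite mulrC ler_pdivrMr // mul1r.
Qed.

Lemma riesz_decomposition (y a b : F) : le 0 a -> le 0 b -> le (labs y) (a + b) ->
  exists2 z, le (labs z) a & le (labs (y - z)) b.
Proof.
move=> a0 b0 /labs_le[yab aby].
have ma : le (- a) a by apply: (vle_lin2 a0 a0); msolve R F.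
(* The witness is [y] truncated to the interval [-a, a]. *)
exists (join (lmeet y a) (- a)).
  apply: labs_leP; first exact: (bl_join_r HF).
  by apply: (bl_join_lub HF) => //; exact: lmeet_ler.
apply: labs_leP.
  have h : le (join (lmeet y a) (- a)) (b + y).
    apply: (bl_join_lub HF); first by apply: (vle_lin2 (lmeet_lel y a) b0); msolve R F.
    by apply: (vle_lin1 aby); msolve R F.
  by apply: (vle_lin1 h); msolve R F.
have h1 := bl_join_l HF (lmeet y a) (- a).
have h2 : le (y - b) (lmeet y a).
  apply: lmeet_glb; first by apply: (vle_lin1 b0); msolve R F.
  by apply: (vle_lin1 yab); msolve R F.
by apply: (vle_lin2 h1 h2); msolve R F.
Qed.

(** The positive cone is closed because (-x)^+ <= (u_n - x)^+, whose norm is at most that of u_n -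
    x. *)
Lemma vle_lim (x : F) (u : nat -> F) :
  u @ \oo --> x -> (forall n, le 0 (u n)) -> le 0 x.
Proof.
move=> ux u0.
suff e : pos (- x) = 0.
  by have := pos_ge (- x); rewrite e => h; apply: (vle_lin1 h); msolve R F.
apply/eqP; rewrite -normr_le0; apply/ler_addgt0Pr => e e0; rewrite add0r.
have /cvgrPdist_le /(_ e e0) [n _ /(_ n (leqnn n)) h] := ux.
apply: le_trans h; rewrite distrC; apply: le_trans (norm_pos_le _).
apply: norm_le; first exact: pos_ge0.
by apply: pos_mono; apply: (vle_lin1 (u0 n)); msolve R F.
Qed.

Lemma vle_lim_le (x y : F) (u : nat -> F) :
  u @ \oo --> x -> (\forall n \near \oo, le (u n) y) -> le x y.
Proof.
move=> ux [N _ uy]; apply/vle_subr_ge0.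
have h : (fun n => y - u (n + N)%N) @ \oo --> y - x.
  by apply: cvgB; [exact: cvg_cst | rewrite (cvg_shiftn N u)].
by apply: vle_lim h _ => n; apply: (vle_subr_ge0 _ _).1; apply: uy; exact: leq_addl.
Qed.

Lemma vle_lim_ge (x y : F) (u : nat -> F) :
  u @ \oo --> x -> (\forall n \near \oo, le y (u n)) -> le y x.
Proof.
move=> /cvgN ux uy.
have h : le (- x) (- y).
  apply: vle_lim_le ux _; apply: filterS uy => n; exact: vle_opp.
by apply: (vle_lin1 h); msolve R F.
Qed.

End Riesz.

(** * The Hahn-Banach theorem *)

(** Homogeneity is asked only as an inequality, which is easier to check; [sublinearZ] recovers
    equality by applying it to the inverse scalar. *)
Definition sublinear {R : realType} {V : lmodType R} (p : V -> R) : Prop :=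
  (forall x y, p (x + y) <= p x + p y) /\
  (forall (a : R) x, 0 <= a -> p (a *: x) <= a * p x).

Section HahnBanach.
Variables (R : realType) (V : lmodType R).
Implicit Types p q : V -> R.

Lemma sublinear0 p : sublinear p -> p 0 = 0.
Proof.
move=> [pD pZ]; apply/eqP; rewrite eq_le; apply/andP; split.
  by have := pZ 0 0 (lexx 0); rewrite scale0r mul0r.
by have := pD 0 0; rewrite addr0; lra.
Qed.

Lemma sublinear_oppr p x : sublinear p -> - p (- x) <= p x.
Proof.
by move=> sp; have := sp.1 x (- x); rewrite subrr (sublinear0 sp); lra.
Qed.

Lemma sublinearZ p (a : R) x : sublinear p -> 0 <= a -> p (a *: x) = a * p x.
Proof.
move=> sp; rewrite le_eqVlt => /predU1P[<-|a0].
  by rewrite scale0r mul0r sublinear0.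
have aV : 0 <= a^-1 by rewrite invr_ge0 ltW.
apply/eqP; rewrite eq_le (sp.2 _ _ (ltW a0)) /=.
by have := sp.2 a^-1 (a *: x) aV; rewrite scalerA mulVf ?gt_eqF // scale1r ler_pdivlMl.
Qed.

(** A sublinear functional below [p] (take t = 0) whose value at -v is at most - p v (take t = 1),
    which makes it additive on the pair v, -v. *)
Definition directional_inf p (v x : V) : R :=
  inf [set p (x + t *: v) - t * p v | t in [set t : R | 0 <= t]].

Lemma directional_inf_has_inf p v x : sublinear p ->
  has_inf [set p (x + t *: v) - t * p v | t in [set t : R | 0 <= t]].
Proof.
move=> sp; split; first by exists (p (x + 0 *: v) - 0 * p v); exists 0 => /=.
exists (- p (- x)) => _ [t /= t0 <-].
have := sp.1 (x + t *: v) (- x); rewrite addrAC subrr add0r.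
by rewrite (sublinearZ _ sp t0); lra.
Qed.

Lemma directional_inf_le p v x (t : R) : sublinear p -> 0 <= t ->
  directional_inf p v x <= p (x + t *: v) - t * p v.
Proof.
by move=> sp t0; apply: ge_inf; [case: (directional_inf_has_inf v x sp) | exists t].
Qed.

Lemma sublinear_directional_inf p v : sublinear p -> sublinear (directional_inf p v).
Proof.
move=> sp; split=> [x y|a x].
  apply/ler_addgt0Pr => e e0; have e2 : 0 < e / 2 by lra.
  have [_ [t /= t0 <-] ht] := inf_adherent e2 (directional_inf_has_inf v x sp).
  have [_ [s /= s0 <-] hs] := inf_adherent e2 (directional_inf_has_inf v y sp).
  have := directional_inf_le v (x + y) sp (addr_ge0 t0 s0).
  have := sp.1 (x + t *: v) (y + s *: v).
  rewrite addrACA -scalerDl; move: ht hs; rewrite -/(directional_inf p v x).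
  by rewrite -/(directional_inf p v y); lra.
rewrite le_eqVlt => /predU1P[<-|a0].
  rewrite scale0r mul0r; have := directional_inf_le v 0 sp (lexx 0).
  by rewrite scale0r addr0 (sublinear0 sp) mul0r subr0.
rewrite -ler_pdivrMl //; apply: lb_le_inf.
  by case: (directional_inf_has_inf v x sp).
move=> _ [t /= t0 <-]; rewrite ler_pdivrMl //.
have at0 : 0 <= a * t by rewrite mulr_ge0 // ltW.
apply: le_trans (directional_inf_le v _ sp at0) _.
rewrite -scalerA -scalerDr (sublinearZ _ sp (ltW a0)).
by rewrite mulrBr mulrA.
Qed.

(** Minimality forces [directional_inf q v] to equal [q] for every [v]; its bound at t = 1 is then
    the missing superadditivity. *)
Lemma minimal_sublinear_is_lin q : sublinear q ->
  (forall p, sublinear p -> (forall x, p x <= q x) -> p = q) -> is_lin q.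
Proof.
move=> sq qmin.
have qD x v : q (x + v) = q x + q v.
  apply/eqP; rewrite eq_le sq.1 /=.
  have e : directional_inf q v = q.
    apply: qmin; first exact: sublinear_directional_inf.
    move=> z; have := directional_inf_le v z sq (lexx 0).
    by rewrite scale0r addr0 mul0r subr0.
  have := directional_inf_le v x sq ler01.
  by rewrite e scale1r mul1r; lra.
have qN x : q (- x) = - q x.
  by have := qD x (- x); rewrite subrr (sublinear0 sq); lra.
move=> a x y; rewrite qD; congr (_ + _).
have [a0|/ltW a0] := leP 0 a; first exact: sublinearZ.
have -> : a *: x = - ((- a) *: x) by rewrite scaleNr opprK.
by rewrite qN sublinearZ ?oppr_ge0 // mulNr opprK.
Qed.

Lemma minimal_sublinear_exists p : sublinear p ->
  exists q, [/\ sublinear q, forall x, q x <= p x &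
    forall r, sublinear r -> (forall x, r x <= q x) -> r = q].
Proof.
move=> sp; pose P (q : V -> R) := sublinear q /\ forall x, q x <= p x.
pose S := {q : V -> R | P q}.
(* The pointwise order is reversed, since Zorn's lemma yields maximal elements. *)
pose ge (q r : S) := `[< forall x, sval r x <= sval q x >].
have [| | | |[q [sq qp]] qmin] := @Zorn S ge.
- by move=> q; apply/asboolP => x.
- move=> q r s /asboolP qr /asboolP rs; apply/asboolP => x.
  exact: le_trans (rs x) (qr x).
- move=> [q hq] [r hr] /asboolP /= qr /asboolP /= rq; apply: eq_exist.
  by apply/funext => x; apply/eqP; rewrite eq_le qr rq.
- move=> A totA.
  (* The empty chain is bounded by [p] itself; a nonempty one by its pointwise infimum. *)
  have [[q0 Aq0]|A0] := pselect (exists q : S, A q); last first.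
    by exists (exist P p (conj sp (fun x => lexx (p x)))) => s As; case: A0; exists s.
  pose E x := [set sval q x | q in A].
  have hE x : has_inf (E x).
    split; first by exists (sval q0 x), q0.
    exists (- p (- x)) => _ [[q [sq qp]] Aq /= <-].
    have := sublinear_oppr x sq; have := qp (- x); lra.
  have Ele (q : S) x : A q -> inf (E x) <= sval q x.
    by move=> Aq; apply: ge_inf; [case: (hE x) | exists q].
  have sI : sublinear (fun x => inf (E x)).
    split=> [x y|a x].
      apply/ler_addgt0Pr => e e0; have e2 : 0 < e / 2 by lra.
      have [_ [q Aq <-] hq] := inf_adherent e2 (hE x).
      have [_ [r Ar <-] hr] := inf_adherent e2 (hE y).
      (* Near-minimisers at x and at y belong to one chain, so the smaller of the two serves at both
         points. *)
      have [s As [sx sy]] : exists2 s, A s & sval s x <= sval q x /\ sval s y <= sval r y.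
        have [/asboolP h|/asboolP h] := totA q r Aq Ar; first by exists r.
        by exists q.
      have := Ele s (x + y) As; have := (svalP s).1.1 x y.
      lra.
    rewrite le_eqVlt => /predU1P[<-|a0].
      rewrite mul0r scale0r; have := Ele q0 0 Aq0.
      by rewrite (sublinear0 (svalP q0).1).
    rewrite -ler_pdivrMl //; apply: lb_le_inf; first by case: (hE x).
    move=> _ [q Aq <-]; rewrite ler_pdivrMl //.
    apply: le_trans (Ele q _ Aq) _; apply: (svalP q).1.2; exact: ltW.
  have Ip x : inf (E x) <= p x.
    exact: le_trans (Ele q0 x Aq0) ((svalP q0).2 x).
  by exists (exist P _ (conj sI Ip)) => s As; apply/asboolP => x /=; exact: Ele.
exists q; split=> // r sr rq.
have rp x : r x <= p x by exact: le_trans (rq x) (qp x).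
have /qmin /(congr1 sval) // : ge (exist P q (conj sq qp)) (exist P r (conj sr rp)).
exact/asboolP.
Qed.

(** The minimal functional is taken below [directional_inf p v] rather than below [p]: this gives f
    (-v) <= - p v, hence f v >= p v. *)
Theorem hahn_banach p (v : V) : sublinear p ->
  exists f, [/\ is_lin f, forall x, f x <= p x & f v = p v].
Proof.
move=> sp; have sv := sublinear_directional_inf v sp.
have [f [sf fp fmin]] := minimal_sublinear_exists sv.
have flin := minimal_sublinear_is_lin sf fmin.
have fle x : f x <= p x.
  apply: le_trans (fp x) _; have := directional_inf_le v x sp (lexx 0).
  by rewrite scale0r addr0 mul0r subr0.
exists f; split => //; apply/eqP; rewrite eq_le fle /=.
have := directional_inf_le v (- v) sp ler01.
rewrite scale1r addNr mul1r (sublinear0 sp).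
have := fp (- v); have := sublinear_oppr v sf.
have : f v + f (- v) = 0.
  by have := flin 1 v (- v); rewrite scale1r subrr mul1r (sublinear0 sf).
lra.
Qed.

End HahnBanach.

(** * Monotone sequences in order intervals *)

Section OrderInterval.
Variables (R : realType) (F : completeNormedModType R).
Variables (le : F -> F -> Prop) (join : F -> F -> F).
Hypothesis HF : is_banach_lattice le join.

Local Notation labs := (labs join).
Local Notation lmeet := (lmeet join).
Local Notation pos := (pospart join).

(** The bound is the sum of the series, which converges by completeness; its geometric majorant sums
    to exactly [e]. *)
Lemma summable_upper_bound (b : nat -> F) (e : R) :
  (forall l, le 0 (b l)) -> (forall l, `|b l| <= e / 2 * 2^-1 ^+ l) ->
  exists2 s, forall l, le (b l) s & `|s| <= e.
Proof.
move=> b0 be.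
have h2 : `|2^-1 : R| < 1 by rewrite ger0_norm ?invr_ge0 // invf_lt1 // ltr1n.
have cg := @cvg_geometric_series R (e / 2) _ h2.
have cn : cvgn [normed series b].
  apply: (@series_le_cvg _ _ (geometric (e / 2) 2^-1)) => //=.
  - by move=> n; apply: le_trans (be n).
  - by apply/cvg_ex; eexists; exact: cg.
have cb := normed_cvg cn.
exists (limn (series b)) => [l|].
  apply: (vle_lim_ge HF cb); exists l.+1 => // n /= ln.
  rewrite /series /= (bigD1_seq l) ?iota_uniq ?mem_index_iota //=.
  have h : le 0 (\sum_(0 <= i < n | i != l) b i).
    elim/big_ind: _ => //; [exact: (bl_refl HF) | exact: (vle_addr_ge0 HF)].
  by have := bl_add HF (b l) h; rewrite add0r addrC.
apply: le_trans (lim_series_norm cn) _.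
have -> : e = limn (series (geometric (e / 2) (2^-1 : R))).
  by rewrite (cvg_lim _ cg) //; field.
apply: ler_lim => //; first by apply/cvg_ex; eexists; exact: cg.
by near=> n; apply: ler_sum => i _; exact: be.
Unshelve. all: by end_near. Qed.

(** Removing from x its excess (x - y)^+ over y leaves an element below both x and y. *)
Lemma pos_split (x y : F) : le (pos x) (pos (lmeet x y) + pos (x - y)).
Proof.
apply: (pos_lub HF); last by apply: (vle_addr_ge0 HF); exact: (pos_ge0 HF).
have h : le (x - pos (x - y)) (lmeet x y).
  apply: (lmeet_glb HF); first by apply: (vle_lin1 HF (pos_ge0 HF (x - y))); msolve R F.
  by apply: (vle_lin1 HF (pos_ge HF (x - y))); msolve R F.
by apply: (vle_lin2 HF h (pos_ge HF (lmeet x y))); msolve R F.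
Qed.

(* [multiplicity N w]: the meet of any [N + 1] terms of [w] is [<= 0]. *)
Fixpoint multiplicity (N : nat) (w : nat -> F) : Prop :=
  if N is M.+1 then forall k, multiplicity M (fun l => lmeet (w k) (w (k.+1 + l)%N))
  else forall k, le (w k) 0.

Definition disjoint_null (y : F) : Prop := forall v : nat -> F,
  (forall n, le 0 (v n) /\ le (v n) y) -> disjoint_seq join v -> v @ \oo --> (0 : F).

(** Small overlaps are removed by subtraction: [s k] dominates the overlaps of [a k] with all other
    terms, and cutting it off leaves [v k] below (a_k - a_l)^+ for every l <> k. Positive and
    negative parts being disjoint, so is [v]. Half of [e] pays for [v], half for [s]. *)
Lemma almost_disjoint_null (y : F) (a : nat -> F) (e : R) : disjoint_null y ->
  le 0 y -> (forall k, le (a k) y) -> 0 < e ->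
  (forall k l, k <> l -> `|pos (lmeet (a k) (a l))| <= e / 2 / 2 * 2^-1 ^+ l) ->
  exists k, `|pos (a k)| <= e.
Proof.
move=> ynull y0 ay e0 ha.
(* The diagonal is set to 0 because the meet of [a k] with itself need not be small. *)
pose b k l := if l == k then 0 else pos (lmeet (a k) (a l)).
have /choice[s /all_and2[sb se]] : forall k, exists s,
    (forall l, le (b k l) s) /\ `|s| <= e / 2.
  move=> k; have [|l|s] := @summable_upper_bound (b k) (e / 2).
  - by move=> l; rewrite /b; case: eqP => _; [exact: (bl_refl HF) | exact: (pos_ge0 HF)].
  - rewrite /b; case: eqP => [_|/nesym/ha //].
    by rewrite normr0 mulr_ge0 ?exprn_ge0 ?invr_ge0 //; lra.
  - by exists s.
pose v k := pos (pos (a k) - s k).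
have s0 k : le 0 (s k) by have := sb k k; rewrite /b eqxx.
have v0 k : le 0 (v k) by exact: (pos_ge0 HF).
have vle k l : k <> l -> le (v k) (pos (a k - a l)).
  move=> kl; apply: (pos_lub HF); last exact: (pos_ge0 HF).
  have := sb k l; rewrite /b; case: eqP => [/esym //|_] h.
  by apply: (vle_lin2 HF h (pos_split (a k) (a l))); msolve R F.
have /cvgr0Pnorm_le /(_ (e / 2)) [|N _ /(_ N (leqnn N)) hN] : v @ \oo --> (0 : F).
  apply: ynull => [n|k l kl].
    split => //; apply: (pos_lub HF) => //.
    apply: (vle_lin2 HF (pos_lub HF (ay n) y0) (s0 n)); rewrite -/pos.
    by msolve R F.
  rewrite !(ge0_labs HF) //; apply: (bl_anti HF); last exact: (lmeet_glb HF).
  apply: (pos_disjoint HF (x := a k - a l)).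
    exact: (bl_trans HF (lmeet_lel HF _ _) (vle k l kl)).
  rewrite opprB; exact: (bl_trans HF (lmeet_ler HF _ _) (vle l k (nesym kl))).
- by rewrite divr_gt0.
exists N; have := se N.
have : `|pos (a N)| <= `|v N + s N|.
  apply: (norm_le HF); first exact: (pos_ge0 HF).
  by apply: (vle_lin1 HF (pos_ge HF (pos (a N) - s N))); rewrite -/(v N); msolve R F.
by have := ler_normD (v N) (s N); lra.
Qed.

(** The meets of a fixed [w k] with later terms have multiplicity one less, so by induction their
    positive parts tend to 0. If infinitely many terms stayed large, a subsequence of them could be
    chosen with overlaps small enough for [almost_disjoint_null]. *)
Lemma multiplicity_null (y : F) (N : nat) (w : nat -> F) : disjoint_null y ->
  le 0 y -> (forall k, le (w k) y) -> multiplicity N w ->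
  (fun k => pos (w k)) @ \oo --> (0 : F).
Proof.
move=> ynull y0; elim: N w => [|N IHN] w wy wN.
  have -> : (fun k => pos (w k)) = (fun=> 0) by apply/funext => k; exact: (pos_le0 HF).
  exact: cvg_cst.
apply/cvgr0Pnorm_le => e e0; apply: contrapT => ne.
have frequently n : exists2 m, (n <= m)%N & e < `|pos (w m)|.
  apply: contrapT => h; apply: ne; exists n => // m /= nm.
  by rewrite leNgt; apply/negP => em; apply: h; exists m.
have meet_small (d : R) k : 0 < d ->
    \forall m \near \oo, `|pos (lmeet (w k) (w m))| <= d.
  move=> d0; have /IHN /(_ (wN k)) : forall l, le (lmeet (w k) (w (k.+1 + l)%N)) y.
    by move=> l; exact: (bl_trans HF (lmeet_lel HF _ _)).
  move=> /cvgr0Pnorm_le /(_ d d0) [n _ hn]; exists (k.+1 + n)%N => // m /= nm.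
  have km : (k.+1 <= m)%N by exact: leq_trans (leq_addr _ _) nm.
  have := hn (m - k.+1)%N; rewrite /= subnKC // leq_subRL //; exact.
have meets_small (d : R) t : 0 < d ->
    \forall m \near \oo, forall k, (k <= t)%N -> `|pos (lmeet (w k) (w m))| <= d.
  move=> d0; elim: t => [|t IHt].
    by apply: filterS (meet_small d 0%N d0) => m hm k; rewrite leqn0 => /eqP ->.
  apply: filterS2 IHt (meet_small d t.+1 d0) => m h1 h2 k.
  by rewrite leq_eqVlt => /predU1P[->//|]; exact: h1.
pose c l : R := e / 2 / 2 * 2^-1 ^+ l.
have c0 l : 0 < c l by rewrite /c mulr_gt0 ?exprn_gt0 ?invr_gt0 //; lra.
(* The pair holds the step number and the last index chosen: the next index is later, its term is
   large, and it overlaps every term up to the last index by at most c_l. *)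
have /choice[nx nxP] : forall lt : nat * nat, exists m, [/\ (lt.2 < m)%N,
    e < `|pos (w m)| &
    forall k, (k <= lt.2)%N -> `|pos (lmeet (w k) (w m))| <= c lt.1].
  move=> [l t] /=; have [n _ hn] := meets_small (c l) t (c0 l).
  have [m] := frequently (maxn n t.+1); rewrite geq_max => /andP[nm tm] em.
  by exists m; split => //; exact: hn.
pose tau := fix tau l := if l is l'.+1 then nx (l, tau l') else nx (0%N, 0%N).
have tau_lt l : (tau l < tau l.+1)%N by have [] := nxP (l.+1, tau l).
have tau_mono : {homo tau : k l / (k <= l)%N}.
  by apply: homo_leq => // [? ? ?|l]; [exact: leq_trans | exact: ltnW].
have tau_big l : e < `|pos (w (tau l))|.
  by case: l => [|l]; [have [] := nxP (0%N, 0%N) | have [] := nxP (l.+1, tau l)].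
have tau_meet k l : (k < l)%N -> `|pos (lmeet (w (tau k)) (w (tau l)))| <= c l.
  case: l => // l; rewrite ltnS => /tau_mono kl.
  by have [_ _ /(_ _ kl)] := nxP (l.+1, tau l).
have cmono k l : (l <= k)%N -> c k <= c l.
  move=> lk; rewrite /c ler_wpM2l //; first lra.
  by rewrite ler_wiXn2l ?invr_ge0 // invf_le1 // ler1n.
have [||k l kl|k] := @almost_disjoint_null y (fun k => w (tau k)) e ynull y0 => //.
(* The bound is known at the larger index; when that is [k], it is weakened since [c] decreases. *)
- case: (ltngtP k l) => [lkl|llk|//]; first exact: tau_meet.
  rewrite (lmeetC HF); apply: le_trans (tau_meet _ _ llk) _; exact: cmono (ltnW llk).
- by rewrite leNgt tau_big.
Qed.

(** Here [j] counts the terms already met into [c], and [M] those still to come. Meeting [c] with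
    u_k - d y trades the summand u_k for one more copy of [c] and moves d y to the right; once j d
    >= 1 the right side is <= 0, which forces c <= 0. *)
Lemma summable_multiplicity (y : F) (d : R) (M j : nat) (c : F) (u : nat -> F) :
  le 0 y -> (forall k, le 0 (u k)) ->
  (forall n, le (j%:R *: c + \sum_(k < n) u k) ((1 - j%:R * d) *: y)) ->
  1 <= (j + M)%:R * d -> multiplicity M (fun k => lmeet c (u k - d *: y)).
Proof.
move=> y0; elim: M j c u => [|M IHM] j c u u0 hc jM /=.
  move=> k; apply: (bl_trans HF (lmeet_lel HF _ _)).
  rewrite addn0 in jM.
  have j0 : 0 < j%:R :> R.
    by rewrite ltr0n lt0n; apply/eqP => j0; move: jM; rewrite j0 mul0r ler10.
  apply: (vle_scale_le0 HF j0); have := hc 0%N; rewrite big_ord0 addr0 => h.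
  have h2 : le 0 ((j%:R * d - 1) *: y) by apply: (vle_scale_ge0 HF) => //; rewrite subr_ge0.
  by apply: (vle_lin2 HF h h2); msolve R F.
move=> k; set a := fun i => u i - d *: y.
(* Both terms of the meet contain [c], and one copy suffices. *)
rewrite (_ : (fun l => _) = fun l => lmeet (lmeet c (a k)) (u (k.+1 + l)%N - d *: y)).
  apply: (IHM j.+1) => [l|n|]; rewrite ?addSnnS //.
  have h : le (\sum_(i < n) u (k.+1 + i)%N + u k) (\sum_(i < k.+1 + n) u i).
    rewrite big_split_ord /= big_ord_recr /=.
    have hk : le 0 (\sum_(i < k) u i).
      by elim/big_ind: _ => //; [exact: (bl_refl HF) | exact: (vle_addr_ge0 HF)].
    by apply: (vle_lin1 HF hk); msolve R F.
  have hj : le (j%:R *: lmeet c (a k)) (j%:R *: c).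
    by apply: (bl_scale HF); [exact: ler0n | exact: (lmeet_lel HF)].
  have ha : le (lmeet c (a k)) (u k - d *: y) by exact: (lmeet_ler HF).
  apply: (bl_trans HF) (_ : le _ (j%:R *: c + \sum_(i < k.+1 + n) u i - d *: y)) _.
    by apply: (vle_lin3 HF h hj ha); rewrite -natr1; msolve R F.
  by apply: (vle_lin1 HF (hc (k.+1 + n)%N)); rewrite -natr1; msolve R F.
apply/funext => l; apply: (bl_anti HF); apply: (lmeet_glb HF).
- exact: (lmeet_lel HF).
- exact: (bl_trans HF (lmeet_ler HF _ _) (lmeet_ler HF _ _)).
- exact: (lmeet_lel HF).
- apply: (lmeet_glb HF); last exact: (lmeet_ler HF).
  exact: (bl_trans HF (lmeet_lel HF _ _) (lmeet_lel HF _ _)).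
Qed.

Lemma summable_null (y : F) (u : nat -> F) : disjoint_null y -> le 0 y ->
  (forall k, le 0 (u k)) -> (forall n, le (\sum_(k < n) u k) y) ->
  u @ \oo --> (0 : F).
Proof.
move=> ynull y0 u0 uy; apply/cvgr0Pnorm_le => e e0.
have y1 : 0 < `|y| + 1 by rewrite ltr_wpDl.
(* The added 1 allows y = 0. The removed part d y costs at most e / 2 in norm, and N >= 1 / d bounds
   the multiplicity of what remains. *)
pose d := e / 2 / (`|y| + 1).
have d0 : 0 < d by rewrite !divr_gt0.
have dy : d * `|y| <= e / 2.
  rewrite /d mulrAC ler_pdivrMr //; rewrite ler_wpM2l //; lra.
pose N := (Num.bound d^-1).
have Nd : 1 <= (0 + N)%:R * d.
  rewrite add0n -ler_pdivrMr // mul1r; apply: ltW; apply: archi_boundP.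
  by rewrite invr_ge0 ltW.
have uy' k : le (u k) y.
  apply: (bl_trans HF) (uy k.+1); rewrite big_ord_recr /=.
  have h : le 0 (\sum_(i < k) u i).
    by elim/big_ind: _ => //; [exact: (bl_refl HF) | exact: (vle_addr_ge0 HF)].
  by apply: (vle_lin1 HF h); msolve R F.
have m : multiplicity N (fun k => lmeet y (u k - d *: y)).
  (* The induction starts with j = 0 and c = y, no term having been absorbed yet. *)
  apply: (@summable_multiplicity y d N 0) => // n.
  by apply: (vle_lin1 HF (uy n)); msolve R F.
have ly k : le (lmeet y (u k - d *: y)) y by exact: (lmeet_lel HF).
have e2 : 0 < e / 2 by rewrite divr_gt0.
have /cvgr0Pnorm_le /(_ _ e2) := multiplicity_null ynull y0 ly m.
apply: filterS => k hk.
have : le (u k) (pos (lmeet y (u k - d *: y)) + d *: y).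
  have h : le (u k - d *: y) (lmeet y (u k - d *: y)).
    apply: (lmeet_glb HF); last exact: (bl_refl HF).
    have dy0 : le 0 (d *: y) by apply: (vle_scale_ge0 HF) => //; exact: ltW.
    by apply: (vle_lin2 HF (uy' k) dy0); msolve R F.
  by apply: (vle_lin2 HF h (pos_ge HF (lmeet y (u k - d *: y)))); msolve R F.
move=> /(norm_le HF (u0 k)) h; apply: le_trans h _.
apply: le_trans (ler_normD _ _) _; rewrite normrZ (ger0_norm (ltW d0)); lra.
Qed.

(** Failure of the Cauchy property gives a subsequence with increments of norm at least [e]. These
    are positive and telescope below [y], so [summable_null] makes them null. *)
Lemma increasing_cvg (y : F) (x : nat -> F) : disjoint_null y ->
  (forall n, le (x n) (x n.+1)) -> (forall n, le 0 (x n)) -> (forall n, le (x n) y) ->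
  cvgn x.
Proof.
move=> ynull xS x0 xy; apply/cauchy_cvgP; apply: cauchy_exP => e e0.
apply: contrapT => ne.
have xm n m : (n <= m)%N -> le (x n) (x m).
  move=> nm; rewrite -(subnKC nm); elim: (m - n)%N => [|k IH].
    by rewrite addn0; exact: (bl_refl HF).
  by rewrite addnS; exact: (bl_trans HF IH (xS _)).
have /choice[nx nxP] : forall n, exists m, (n <= m)%N /\ e <= `|x m - x n|.
  move=> n; apply: contrapT => h; apply: ne; exists (x n), n => // m /= nm.
  rewrite -ball_normE /= distrC ltNge; apply/negP => em; apply: h.
  by exists m.
pose u k := x (iter k.+1 nx 0%N) - x (iter k nx 0%N).
have u0 k : le 0 (u k).
  apply: (vle_subr_ge0 HF _ _).1; apply: xm; by have [] := nxP (iter k nx 0%N).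
have us n : \sum_(k < n) u k = x (iter n nx 0%N) - x 0%N.
  elim: n => [|n IHn]; first by rewrite big_ord0 subrr.
  by rewrite big_ord_recr /= IHn /u /=; msolve R F.
have y0 : le 0 y by exact: (bl_trans HF (x0 0%N)).
have /cvgr0Pnorm_lt /(_ e e0) [N _ /(_ N (leqnn N))] : u @ \oo --> (0 : F).
  apply: summable_null ynull y0 u0 _ => n.
  by rewrite us; apply: (vle_lin2 HF (xy (iter n nx 0%N)) (x0 0%N)); msolve R F.
by rewrite /u /= ltNge; have [_ ->] := nxP (iter N nx 0%N).
Qed.

Lemma decreasing_cvg (y : F) (x : nat -> F) : disjoint_null y ->
  (forall n, le (x n.+1) (x n)) -> (forall n, le 0 (x n)) -> (forall n, le (x n) y) ->
  cvgn x.
Proof.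
move=> ynull xS x0 xy.
have : cvgn (fun n => y - x n).
  apply: (increasing_cvg ynull) => n.
  - by apply: (vle_lin1 HF (xS n)); msolve R F.
  - exact: (vle_subr_ge0 HF _ _).1.
  - by apply: (vle_lin1 HF (x0 n)); msolve R F.
move=> /cvg_ex[l cl]; apply/cvg_ex; exists (y - l).
have -> : x = (fun n => y - (y - x n)) by apply/funext => n; msolve R F.
by apply: cvgB cl; exact: cvg_cst.
Qed.

End OrderInterval.

(** * Moduli of bounded functionals *)

Section LinearFunctional.
Variables (R : realType) (V : normedModType R) (f : V -> R).
Hypothesis flin : is_lin f.

Lemma is_linD (x y : V) : f (x + y) = f x + f y.
Proof. by have := flin 1 x y; rewrite scale1r mul1r. Qed.

Lemma is_lin0 : f 0 = 0.
Proof. by have := is_linD 0 0; rewrite addr0; lra. Qed.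

Lemma is_linN (x : V) : f (- x) = - f x.
Proof. by have := is_linD x (- x); rewrite subrr is_lin0; lra. Qed.

Lemma is_linB (x y : V) : f (x - y) = f x - f y.
Proof. by rewrite is_linD is_linN. Qed.

Lemma is_linZ (a : R) (x : V) : f (a *: x) = a * f x.
Proof. by have := flin a x 0; rewrite !addr0 is_lin0 addr0. Qed.

Lemma bounded_is_dual (M : R) : (forall x, `|f x| <= M * `|x|) -> is_dual f.
Proof.
move=> fM; split => // x; apply/cvgrPdist_le => e e0.
have M1 : 0 < `|M| + 1 by rewrite ltr_wpDl.
near=> z; rewrite -is_linB.
have : `|x - z| <= e / (`|M| + 1).
  by near: z; apply: cvgr_dist_le => //; rewrite divr_gt0.
rewrite ler_pdivlMr // => h; apply: le_trans h.
apply: le_trans (fM _) _; rewrite mulrC ler_wpM2l //.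
by apply: le_trans (ler_norm _) _; rewrite lerDl.
Unshelve. all: by end_near. Qed.

End LinearFunctional.

Section DualModulus.
Variables (R : realType) (F : normedModType R).
Variables (le : F -> F -> Prop) (join : F -> F -> F).
Hypothesis HF : is_banach_lattice le join.
Variables (f : F -> R) (M : R).
Hypotheses (flin : is_lin f) (fM : forall x, `|f x| <= M * `|x|) (M0 : 0 <= M).

Local Notation labs := (labs join).
Local Notation dmod := (dual_mod le join f).

Lemma dual_mod_le (x : F) (c : R) : le 0 x ->
  (forall y, le (labs y) x -> `|f y| <= c) -> dmod x <= c.
Proof.
move=> x0 h; apply: ge_sup; last by move=> _ [y /= yx <-]; exact: h.
exists `|f 0|, 0 => //=; rewrite (ge0_labs HF) //; exact: (bl_refl HF).
Qed.

(** Boundedness of [f] bounds the set from above, so that [sup] is a true supremum and not its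
    default value. *)
Lemma dual_mod_ge (x y : F) : le (labs y) x -> `|f y| <= dmod x.
Proof.
move=> yx; apply: ub_le_sup; last by exists y.
exists (M * `|x|) => _ [z /= zx <-]; apply: le_trans (fM z) _.
by rewrite ler_wpM2l //; exact: (norm_labs_le HF).
Qed.

Lemma dual_mod_ge0 (x : F) : le 0 x -> 0 <= dmod x.
Proof.
by move=> x0; apply: le_trans (normr_ge0 (f x)) _; apply: dual_mod_ge;
  rewrite (ge0_labs HF) //; exact: (bl_refl HF).
Qed.

Lemma dual_mod_mono (x y : F) : le 0 x -> le x y -> dmod x <= dmod y.
Proof.
by move=> x0 xy; apply: dual_mod_le => // z zx; apply: dual_mod_ge; exact: (bl_trans HF zx).
Qed.

Lemma dual_mod_norm (x : F) : le 0 x -> dmod x <= M * `|x|.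
Proof.
move=> x0; apply: dual_mod_le => // y yx; apply: le_trans (fM y) _.
by rewrite ler_wpM2l //; exact: (norm_labs_le HF).
Qed.

(** By Riesz decomposition an element dominated by x + y splits into parts dominated by x and by
    y. *)
Lemma dual_modD (x y : F) : le 0 x -> le 0 y -> dmod (x + y) <= dmod x + dmod y.
Proof.
move=> x0 y0; apply: dual_mod_le; first exact: (vle_addr_ge0 HF).
move=> z /(riesz_decomposition HF x0 y0)[a ax by_].
rewrite (_ : f z = f a + f (z - a)); last by rewrite -is_linD // addrC subrK.
by apply: le_trans (ler_normD _ _) _; apply: lerD; exact: dual_mod_ge.
Qed.

Lemma dual_mod_le_add (x a b : F) : le 0 x -> le 0 a -> le 0 b -> le x (a + b) ->
  dmod x <= dmod a + dmod b.
Proof.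
move=> x0 a0 b0 xab; apply: le_trans (dual_modD a0 b0).
exact: dual_mod_mono.
Qed.

Lemma dual_mod_approx (x z : F) : le 0 x -> le 0 z ->
  dmod x <= dmod z + M * `|x - z|.
Proof.
move=> x0 z0; apply: (le_trans (dual_mod_le_add x0 z0 (labs_ge0 HF (x - z)) _)).
  by apply: (vle_lin1 HF (labs_ge HF (x - z))); msolve R F.
by rewrite lerD2l -(norm_labs HF (x - z)); apply: dual_mod_norm; exact: (labs_ge0 HF).
Qed.

End DualModulus.

(** * Disjoint sequences of functionals on an order interval *)

Section DisjointFunctionals.
Variables (R : realType) (F : completeNormedModType R).
Variables (le : F -> F -> Prop) (join : F -> F -> F).
Hypothesis HF : is_banach_lattice le join.
Variables (f : nat -> F -> R) (M : R).
Hypotheses (flin : forall n, is_lin (f n)) (fM : forall n x, `|f n x| <= M * `|x|).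
Hypothesis M0 : 0 <= M.
Hypothesis fdisj : dual_disjoint_seq le join f.

Local Notation g n := (dual_mod le join (f n)).

Lemma disjoint_pair_split (y : F) (n m : nat) (e : R) : le 0 y -> n <> m -> 0 < e ->
  exists z, [/\ le 0 z, le z y, g m z <= e & g n (y - z) <= e].
Proof.
(* The indices are swapped so that in the infimum [f m] is evaluated on z and [f n] on y - z. *)
move=> y0 nm e0; have h := fdisj (nesym nm) y0.
have yz z : le z y -> le 0 (y - z) by exact: (vle_subr_ge0 HF _ _).1.
rewrite /dual_meet_mod in h; set E := (X in inf X = 0) in h.
have hE : has_inf E.
  split; first by exists (g m 0 + g n (y - 0)), 0 => //; split => //; exact: (bl_refl HF).
  exists 0 => _ [z [z0 zy] <-].
  apply: addr_ge0; first exact: (dual_mod_ge0 HF (fM m) M0 z0).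
  exact: (dual_mod_ge0 HF (fM n) M0 (yz _ zy)).
have [_ [z [z0 zy] <-]] := inf_adherent e0 hE.
rewrite -/E [inf E]h add0r => hz.
have := dual_mod_ge0 HF (fM m) M0 z0; have := dual_mod_ge0 HF (fM n) M0 (yz _ zy).
by exists z; split => //; lra.
Qed.

(** Each step takes the meet x of the old witness z with a pair witness z'. Since y - x <= (y - z) +
    (y - z'), halving [e] at every step keeps the error at [n] under control. *)
Lemma disjoint_finite_split (y : F) (n j : nat) (e : R) : le 0 y -> (j <= n)%N -> 0 < e ->
  exists z, [/\ le 0 z, le z y, forall m, (m < j)%N -> g m z <= e & g n (y - z) <= e].
Proof.
move=> y0; elim: j e => [|j IHj] e jn e0.
  exists y; split => //; first exact: (bl_refl HF).
  rewrite subrr; apply: le_trans (dual_mod_norm HF (fM n) M0 (bl_refl HF 0)) _.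
  by rewrite normr0 mulr0 ltW.
have e2 : 0 < e / 2 by rewrite divr_gt0.
have [z [z0 zy gz gyz]] := IHj (e / 2) (ltnW jn) e2.
have nj : n <> j by move=> nj; move: jn; rewrite nj ltnn.
have [z' [z0' zy' gz' gyz']] := disjoint_pair_split y0 nj e2.
set x := lmeet join z z'.
have x0 : le 0 x by exact: (lmeet_glb HF).
have xz : le x z by exact: (lmeet_lel HF).
have xz' : le x z' by exact: (lmeet_ler HF).
have xy : le x y by exact: (bl_trans HF xz).
exists x; split => //.
  move=> m; rewrite ltnS leq_eqVlt => /predU1P[->|mj].
    by apply: le_trans (dual_mod_mono HF (fM j) M0 x0 xz') _; lra.
  apply: le_trans (dual_mod_mono HF (fM m) M0 x0 xz) _.
  by have := gz m mj; lra.
have sub (a : F) : le a y -> le 0 (y - a) by exact: (vle_subr_ge0 HF _ _).1.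
have h := dual_mod_le_add HF (flin n) (fM n) M0 (sub _ xy) (sub _ zy) (sub _ zy').
apply: le_trans (h _) _; last lra.
have k : le (z + z' - y) x.
  apply: (lmeet_glb HF); first by apply: (vle_lin1 HF zy'); msolve R F.
  by apply: (vle_lin1 HF zy); msolve R F.
by apply: (vle_lin1 HF k); msolve R F.
Qed.

(** The terms joined are those of index n to n + k inclusive, so the limit in k is a tail
    supremum. *)
Fixpoint partial_join (z : nat -> F) (n k : nat) : F :=
  if k is k'.+1 then join (partial_join z n k') (z (n + k)%N) else z n.

Lemma disjoint_dual_mod_null (y : F) : disjoint_null le join y -> le 0 y ->
  (fun n => g n y) @ \oo --> (0 : R).
Proof.
move=> ynull y0.
pose eps n : R := 2^-1 ^+ n.
have eps0 n : 0 < eps n by rewrite exprn_gt0 // invr_gt0.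
have epsS n : eps n = 2 * eps n.+1 by rewrite /eps exprS; field.
have /choice[z zP] : forall n, exists z, [/\ le 0 z, le z y,
    forall m, (m < n)%N -> g m z <= eps n & g n (y - z) <= eps n].
  by move=> n; exact: disjoint_finite_split.
pose W := partial_join z.
have WS n k : le (W n k) (W n k.+1) by exact: (bl_join_l HF).
have zW n k : le (z n) (W n k).
  elim: k => [|k IH]; first exact: (bl_refl HF).
  exact: (bl_trans HF IH (WS n k)).
have W0 n k : le 0 (W n k) by have [z0 _ _ _] := zP n; exact: (bl_trans HF z0 (zW n k)).
have Wy n k : le (W n k) y.
  elim: k => [|k IH]; first by have [] := zP n.
  by apply: (bl_join_lub HF) => //; have [] := zP (n + k.+1)%N.
have WSn n k : le (W n.+1 k) (W n k.+1).
  elim: k => [|k IH]; first by rewrite /W /= addn1; exact: (bl_join_r HF).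
  apply: (bl_join_lub HF); first exact: (bl_trans HF IH (WS n k.+1)).
  rewrite addSnnS; exact: (bl_join_r HF).
(* The right side is the exact sum of eps_i for n <= i <= n + k; keeping the subtracted term makes
   the induction close. *)
have gW n k m : (m < n)%N -> g m (W n k) <= 2 * eps n - eps (n + k)%N.
  move=> mn; elim: k => [|k IH].
    by rewrite addn0; have [_ _ /(_ m mn) + _] := zP n; rewrite /W /=; lra.
  have [zk0 _ /(_ m (leq_trans mn (leq_addr _ _))) gz _] := zP (n + k.+1)%N.
  have le_add : le (W n k.+1) (W n k + z (n + k.+1)%N).
    have h : le (W n k) (W n k + z (n + k.+1)%N) by apply: (vle_lin1 HF zk0); msolve R F.
    by apply: (bl_join_lub HF h); apply: (vle_lin1 HF (W0 n k)); msolve R F.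
  have := dual_mod_le_add HF (flin m) (fM m) M0 (W0 n k.+1) (W0 n k) zk0 le_add.
  have := epsS (n + k)%N; rewrite addnS in gz *; lra.
have /choice[w wP] : forall n, exists w : F, W n @ \oo --> w.
  by move=> n; apply/cvg_ex; exact: (increasing_cvg HF ynull).
have w0 n : le 0 (w n) by apply: (vle_lim HF (wP n)).
have zw n : le (z n) (w n) by apply: (vle_lim_ge HF (wP n)); exact: nearW.
have wy n : le (w n) y by apply: (vle_lim_le HF (wP n)); exact: nearW.
(* Dropping [z n] shrinks the tail: each [W n.+1 k] lies below [W n k.+1], hence below [w n]. *)
have wS n : le (w n.+1) (w n).
  apply: (vle_lim_le HF (wP n.+1)); apply: nearW => k.
  apply: (bl_trans HF (WSn n k)).
  apply: (vle_lim_ge HF (wP n)); exists k.+1 => // l /= kl.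
  rewrite -(subnKC kl); elim: (l - k.+1)%N => [|i IH].
    by rewrite addn0; exact: (bl_refl HF).
  by rewrite addnS; exact: (bl_trans HF IH (WS _ _)).
have gw n m : (m < n)%N -> g m (w n) <= 2 * eps n.
  move=> mn; apply/ler_addgt0Pr => e e0.
  have e1 : 0 < e / (M + 1) by rewrite divr_gt0 // ltr_wpDl.
  have /cvgrPdist_le /(_ _ e1) [k _ /(_ k (leqnn k)) hk] := wP n.
  have := dual_mod_approx HF (flin m) (fM m) M0 (w0 n) (W0 n k).
  have : M * `|w n - W n k| <= e.
    rewrite ler_pdivlMr ?ltr_wpDl // in hk; apply: le_trans hk.
    by rewrite mulrC ler_wpM2l // lerDl.
  have := gW n k m mn; have := eps0 (n + k)%N; lra.
have /cvg_ex[wl cwl] : cvgn w by exact: (decreasing_cvg HF ynull).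
have wl0 : le 0 wl by exact: (vle_lim HF cwl).
have wlw n : le wl (w n).
  apply: (vle_lim_le HF cwl); exists n => // l /= nl.
  rewrite -(subnKC nl); elim: (l - n)%N => [|i IH].
    by rewrite addn0; exact: (bl_refl HF).
  by rewrite addnS; exact: (bl_trans HF (wS _) IH).
have epscvg : eps @ \oo --> (0 : R).
  by apply: cvg_expr; rewrite ger0_norm ?invr_ge0 // invf_lt1 // ltr1n.
(* The limit lies below every [w n], and for n > m the modulus at [w n] is at most 2 eps_n, which is
   arbitrarily small. *)
have gwl m : g m wl <= 0.
  apply/ler_addgt0Pr => e e0; rewrite add0r.
  have e2 : 0 < e / 2 by rewrite divr_gt0.
  have /cvgr0Pnorm_le /(_ _ e2) [n _ hn] := epscvg.
  have := hn (maxn n m.+1) (leq_maxl _ _); rewrite /= (ger0_norm (ltW (eps0 _))).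
  have := gw (maxn n m.+1) m (leq_maxr _ _).
  have := dual_mod_mono HF (fM m) M0 wl0 (wlw (maxn n m.+1)); lra.
(* Split y as z_n + (y - z_n): the second part costs eps_n, and z_n <= w_n differs from an element
   annihilated by |f_n| only by w_n - wl. *)
have bound n : g n y <= M * `|w n - wl| + eps n.
  have [z0 zy _ gyz] := zP n.
  have yz0 : le 0 (y - z n) by exact: (vle_subr_ge0 HF _ _).1.
  have := dual_mod_le_add HF (flin n) (fM n) M0 y0 z0 yz0.
  rewrite addrC subrK => /(_ (bl_refl HF y)).
  have := dual_mod_mono HF (fM n) M0 z0 (zw n).
  have := dual_mod_approx HF (flin n) (fM n) M0 (w0 n) wl0.
  have := gwl n; lra.
have bcvg : (fun n => M * `|w n - wl| + eps n) @ \oo --> (0 : R).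
  rewrite -[0 in X in _ --> X]addr0; apply: cvgD epscvg.
  rewrite -(mulr0 M); apply: cvgMl_tmp; rewrite -(normr0 F); apply: cvg_norm.
  by rewrite -(subrr wl); apply: cvgB => //; exact: cvg_cst.
apply: squeeze_cvgr (cvg_cst _) bcvg; apply: nearW => n.
by rewrite bound (dual_mod_ge0 HF (fM n) M0).
Qed.

End DisjointFunctionals.

(** * Functionals carried by disjoint elements *)

Section BandSeminorm.
Variables (R : realType) (F : normedModType R).
Variables (le : F -> F -> Prop) (join : F -> F -> F).
Hypothesis HF : is_banach_lattice le join.

Local Notation labs := (labs join).
Local Notation lmeet := (lmeet join).
Local Notation pos := (pospart join).

(** Hahn-Banach for the norm of the positive part: this vanishes on the negative cone, which makes
    [phi] positive, and equals the norm at [u]. *)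
Lemma positive_norming_functional (u : F) : le 0 u ->
  exists phi, [/\ is_lin phi, forall x, le 0 x -> 0 <= phi x,
    forall x, `|phi x| <= `|x| & phi u = `|u|].
Proof.
move=> u0; pose p x := `|pos x|.
have sp : sublinear p.
  split=> [x y|a x a0]; rewrite /p.
    apply: le_trans (ler_normD _ _); apply: (norm_le HF); first exact: (pos_ge0 HF).
    apply: (pos_lub HF); first by apply: (vle_add HF); exact: (pos_ge HF).
    by apply: (vle_addr_ge0 HF); exact: (pos_ge0 HF).
  rewrite -[X in _ <= X * _](ger0_norm a0) -normrZ; apply: (norm_le HF).
    exact: (pos_ge0 HF).
  apply: (pos_lub HF); first by apply: (bl_scale HF) => //; exact: (pos_ge HF).
  by apply: (vle_scale_ge0 HF) => //; exact: (pos_ge0 HF).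
have [phi [plin pp pu]] := hahn_banach u sp.
have ple x : phi x <= `|x| by exact: le_trans (pp x) (norm_pos_le HF x).
exists phi; split => //.
- move=> x x0; have := pp (- x); rewrite (is_linN plin) /p (pos_le0 HF) ?normr0 ?oppr_le0 //.
  by apply: (vle_lin1 HF x0); msolve R F.
- move=> x; rewrite ler_norml ple andbT lerNl -(is_linN plin).
  by rewrite -[X in _ <= X]normrN.
- rewrite pu /p; congr `|_|; apply: (bl_anti HF) (pos_ge HF u).
  by apply: (pos_lub HF) => //; exact: (bl_refl HF).
Qed.

Variables (phi : F -> R) (u : F).
Hypotheses (plin : is_lin phi) (ppos : forall x, le 0 x -> 0 <= phi x).
Hypotheses (pnorm : forall x, `|phi x| <= `|x|) (u0 : le 0 u).

(* On [x >= 0] this is the least positive extension of the restriction of [phi] to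
   the ideal generated by [u]. *)
Definition band_seminorm (x : F) : R :=
  sup [set phi (lmeet (labs x) (k *: u)) | k in [set k : R | 0 <= k]].

Let phi_mono (x y : F) : le x y -> phi x <= phi y.
Proof.
by move=> xy; rewrite -subr_ge0 -is_linB //; apply: ppos; exact: (vle_subr_ge0 HF _ _).1.
Qed.

Lemma band_seminorm_ge (x : F) (k : R) : 0 <= k ->
  phi (lmeet (labs x) (k *: u)) <= band_seminorm x.
Proof.
move=> k0; apply: ub_le_sup; last by exists k.
by exists (phi (labs x)) => _ [j _ <-]; apply: phi_mono; exact: (lmeet_lel HF).
Qed.

Lemma band_seminorm_le (x : F) (c : R) :
  (forall k, 0 <= k -> phi (lmeet (labs x) (k *: u)) <= c) -> band_seminorm x <= c.
Proof.
move=> h; apply: ge_sup; last by move=> _ [k k0 <-]; exact: h.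
by exists (phi (lmeet (labs x) (0 *: u))), 0 => /=.
Qed.

Lemma band_seminorm_norm (x : F) : band_seminorm x <= `|x|.
Proof.
apply: band_seminorm_le => k k0; rewrite -(norm_labs HF x).
apply: le_trans (phi_mono (lmeet_lel HF _ _)) _.
exact: le_trans (ler_norm _) (pnorm _).
Qed.

Lemma band_seminorm_mono (x y : F) : le (labs x) (labs y) ->
  band_seminorm x <= band_seminorm y.
Proof.
move=> xy; apply: band_seminorm_le => k k0; apply: le_trans (band_seminorm_ge y k0).
by apply: phi_mono; apply: (lmeet_mono HF) => //; exact: (bl_refl HF).
Qed.

Lemma band_seminormN (x : F) : band_seminorm (- x) = band_seminorm x.
Proof. by rewrite /band_seminorm (labsN HF). Qed.

Lemma band_seminorm_sublinear : sublinear band_seminorm.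
Proof.
split=> [x y|a x].
  apply: band_seminorm_le => k k0.
  apply: le_trans (lerD (band_seminorm_ge x k0) (band_seminorm_ge y k0)).
  rewrite -is_linD //; apply: phi_mono.
  have ku : le 0 (k *: u) by exact: (vle_scale_ge0 HF).
  apply: (bl_trans HF) (lmeet_addl HF (labs_ge0 HF x) (labs_ge0 HF y) ku).
  by apply: (lmeet_mono HF); [exact: (labsD HF) | exact: (bl_refl HF)].
rewrite le_eqVlt => /predU1P[<-|a0].
  rewrite scale0r mul0r; apply: band_seminorm_le => k k0.
  rewrite -(is_lin0 plin); apply: phi_mono; apply: (bl_trans HF (lmeet_lel HF _ _)).
  by rewrite (ge0_labs HF); exact: (bl_refl HF).
apply: band_seminorm_le => k k0.
have aV : 0 <= a^-1 by rewrite invr_ge0 ltW.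
have ka0 : 0 <= k / a by rewrite mulr_ge0.
(* Scaling x by a > 0 only reindexes the supremum, replacing k by k / a. *)
apply: le_trans (_ : phi (a *: lmeet (labs x) ((k / a) *: u)) <= _); last first.
  by rewrite is_linZ // ler_pM2l //; exact: band_seminorm_ge.
apply: phi_mono.
have h : le (a^-1 *: lmeet (labs (a *: x)) (k *: u)) (lmeet (labs x) ((k / a) *: u)).
  apply: (lmeet_glb HF).
    have h := lmeet_lel HF (labs (a *: x)) (k *: u).
    have := bl_scale HF aV (bl_trans HF h (labsZ HF x (ltW a0))).
    by rewrite [X in le _ X]scalerA mulVf ?gt_eqF // scale1r.
  have := bl_scale HF aV (lmeet_ler HF (labs (a *: x)) (k *: u)).
  by rewrite [X in le _ X]scalerA mulrC.
by have := bl_scale HF (ltW a0) h; rewrite scalerA mulfV ?gt_eqF // scale1r.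
Qed.

(** A truncation of the remainder at j u, added to the truncation of x at k u, is a positive element
    below x and below (j + k) u. A nearly optimal truncation thus leaves a remainder of small
    seminorm. *)
Lemma band_seminorm_remainder (x : F) (k : R) : le 0 x -> 0 <= k ->
  band_seminorm (x - lmeet x (k *: u)) <= band_seminorm x - phi (lmeet x (k *: u)).
Proof.
move=> x0 k0; apply: band_seminorm_le => j j0.
set y := lmeet x (k *: u).
have xy0 : le 0 (x - y) by apply: (vle_subr_ge0 HF _ _).1; exact: (lmeet_lel HF).
rewrite lerBrDr -is_linD // (ge0_labs HF xy0).
apply: le_trans (band_seminorm_ge x (addr_ge0 j0 k0)); apply: phi_mono.
rewrite (ge0_labs HF x0); apply: (lmeet_glb HF).
  by apply: (vle_lin1 HF (lmeet_lel HF (x - y) (j *: u))); msolve R F.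
apply: (vle_lin2 HF (lmeet_ler HF (x - y) (j *: u)) (lmeet_ler HF x (k *: u))).
by rewrite -/y; msolve R F.
Qed.

Lemma band_seminorm_disjoint (x v : F) (k : R) : le 0 v -> lmeet u v = 0 -> 0 <= k ->
  le 0 x -> le x (k *: v) -> band_seminorm x <= 0.
Proof.
move=> v0 uv k0 x0 xv; apply: band_seminorm_le => j j0.
rewrite -(is_lin0 plin); apply: phi_mono.
rewrite -(lmeetZ HF j0 k0 u0 v0 uv) (lmeetC HF) (ge0_labs HF x0).
by apply: (lmeet_mono HF) => //; exact: (bl_refl HF).
Qed.

End BandSeminorm.

(** * Disjoint functionals norming a disjoint sequence *)

Section DisjointNorming.
Variables (R : realType) (F : normedModType R).
Variables (le : F -> F -> Prop) (join : F -> F -> F).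
Hypothesis HF : is_banach_lattice le join.

Local Notation labs := (labs join).
Local Notation lmeet := (lmeet join).

Lemma disjoint_norming_functionals (u v : nat -> F) : disjoint_seq join u ->
  (forall n, le (labs (u n)) (labs (v n))) ->
  exists h : nat -> F -> R, [/\ forall n, is_lin (h n), forall n x, `|h n x| <= `|x|,
    dual_disjoint_seq le join h & forall n, `|u n| <= h n (v n)].
Proof.
move=> udisj uv.
have /choice[phi phiP] n := positive_norming_functional HF (labs_ge0 HF (u n)).
pose p n := band_seminorm join (phi n) (labs (u n)).
have pge n x k : 0 <= k -> phi n (lmeet (labs x) (k *: labs (u n))) <= p n x.
  by have [a b _ _] := phiP n; exact: (band_seminorm_ge HF).
have psub n : sublinear (p n).
  by have [a b c _] := phiP n; exact: (band_seminorm_sublinear HF a b (labs_ge0 HF _)).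
have /choice[h hP] n := hahn_banach (v n) (psub n).
(* The seminorm is even, so the one-sided Hahn-Banach bound controls the absolute value. *)
have habs n x : `|h n x| <= p n x.
  have [hlin hp _] := hP n; rewrite ler_norml hp andbT lerNl -(is_linN hlin).
  by rewrite /p -(band_seminormN HF); exact: hp.
have hnorm n x : `|h n x| <= `|x|.
  have [a b c _] := phiP n; apply: le_trans (habs n x) _.
  exact: (band_seminorm_norm HF).
have modp n x : le 0 x -> dual_mod le join (h n) x <= p n x.
  move=> x0; apply: (dual_mod_le HF) => // y yx; apply: le_trans (habs n y) _.
  have [a b c _] := phiP n; apply: (band_seminorm_mono HF _ a b).
  by rewrite (ge0_labs HF x0).
have hM n x : `|h n x| <= 1 * `|x| by rewrite mul1r.
exists h; split => //.
- by move=> n; have [] := hP n.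
- move=> n m nm x x0; rewrite /dual_meet_mod; set E := [set _ | _ in _].
  have sub (z : F) : le z x -> le 0 (x - z) by exact: (vle_subr_ge0 HF _ _).1.
  have lbE : lbound E 0.
    move=> _ [z [z0 zx] <-]; apply: addr_ge0.
      exact: (dual_mod_ge0 HF (hM n) ler01 z0).
    exact: (dual_mod_ge0 HF (hM m) ler01 (sub _ zx)).
  have Ene : E !=set0.
    by exists (dual_mod le join (h n) 0 + dual_mod le join (h m) (x - 0)), 0 => //;
      split => //; exact: (bl_refl HF).
  apply/eqP; rewrite eq_le lb_le_inf // andbT.
  apply/ler_addgt0Pr => e e0; rewrite add0r.
  have [am bm cm _] := phiP m; have [an bn cn _] := phiP n.
  have um0 := labs_ge0 HF (u m).
  have hs : has_sup [set phi m (lmeet (labs x) (k *: labs (u m))) | k in [set k : R | 0 <= k]].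
    split; first by exists (phi m (lmeet (labs x) (0 *: labs (u m)))), 0 => /=.
    by exists (p m x) => _ [k k0 <-]; exact: pge.
  have [_ [k /= k0 <-]] := sup_adherent e0 hs.
  rewrite -/(band_seminorm join (phi m) (labs (u m)) x) (ge0_labs HF x0) => hk.
  (* This truncation nearly attains p_m(x), so p_m(x - z) < e, while p_n(z) <= 0 because [u n] and
     [u m] are disjoint. *)
  set z := lmeet x (k *: labs (u m)) in hk.
  have z0 : le 0 z by apply: (lmeet_glb HF) => //; exact: (vle_scale_ge0 HF).
  have zx : le z x by exact: (lmeet_lel HF).
  apply: le_trans (_ : dual_mod le join (h n) z + dual_mod le join (h m) (x - z) <= _).
    by apply: ge_inf; [exists 0 | exists z].
  have h1 : dual_mod le join (h n) z <= 0.
    apply: le_trans (modp n z z0) _.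
    apply: (band_seminorm_disjoint HF an bn (labs_ge0 HF _) um0 (udisj _ _ nm) k0 z0).
    exact: (lmeet_ler HF).
  have h2 := modp m _ (sub _ zx).
  have h3 := band_seminorm_remainder HF (labs (u m)) am bm x0 k0.
  by rewrite -/z -/(p m _) -/(p m _) in h3; rewrite -/(p m x) in hk; lra.
(* The truncation at k = 1 returns |u_n| itself, as |u_n| <= |v_n|, and [phi n] norms it. *)
- move=> n; have [_ _ ->] := hP n; have [a b c d] := phiP n.
  rewrite -(norm_labs HF) -d; apply: le_trans (pge n (v n) 1 ler01); rewrite scale1r.
  by rewrite (_ : lmeet _ _ = labs (u n)) //; apply: (bl_anti HF);
    [exact: (lmeet_ler HF) | apply: (lmeet_glb HF) => //; exact: (bl_refl HF)].
Qed.

End DisjointNorming.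

Theorem theorem2p8 (R : realType) (X F : completeNormedModType R)
  (le : F -> F -> Prop) (join : F -> F -> F)
  (HF : is_banach_lattice le join)
  (T : {linear X -> F}) (hT : continuous T) :
  limitedly_Lwc le join T <->
  (forall f : nat -> F -> R, (forall n, is_dual (f n)) ->
     dual_seq_bounded f -> dual_disjoint_seq le join f ->
     forall x : X, (fun n => f n (T x)) @ \oo --> (0 : R)).
Proof.
split=> [TL f fdual [M fM] fdisj x|H A [_ Alim] u uA udisj].
- have flin n : is_lin (f n) by have [] := fdual n.
  (* The given bound need not be nonnegative, as the estimates on moduli require. *)
  have fM' n z : `|f n z| <= `|M| * `|z|.
    by apply: le_trans (fM n z) _; rewrite ler_wpM2r // ler_norm.
  have ynull : disjoint_null le join (labs join (T x)).
    (* The interval [0, |T x|] lies in the solid hull of the image of {x}, and a singleton is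
       limited by pointwise convergence. *)
    move=> v vy vdisj; apply: (TL [set x]) vdisj => [|n].
      split; first by exists `|x| => _ ->.
      move=> g gdual gnull e e0.
      have /cvgr0Pnorm_le /(_ _ e0) := gnull x.
      by apply: filterS => n gn _ ->.
    have [v0 vle] := vy n; exists (T x); first by exists x.
    split => //; apply: (bl_trans HF) v0.
    by apply: (vle_lin1 HF (labs_ge0 HF (T x))); msolve R F.
  have y0 := labs_ge0 HF (T x).
  have /cvgr0Pnorm_le gnull := disjoint_dual_mod_null HF flin fM' (normr_ge0 M) fdisj ynull y0.
  apply/cvgr0Pnorm_le => e /gnull; apply: filterS => n /(le_trans (ler_norm _)).
  apply: le_trans; apply: (dual_mod_ge HF (fM' n)) => //; exact: (bl_refl HF).
- have /choice[a aP] n : exists a, A a /\ le (labs join (u n)) (labs join (T a)).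
    have [_ [a Aa <-] [h1 h2]] := uA n; exists a; split => //.
    exact: (labs_leP HF).
  have [h [hlin hnorm hdisj hu]] :=
    disjoint_norming_functionals HF udisj (fun n => (aP n).2).
  have hdual n : is_dual (h n).
    by apply: (@bounded_is_dual _ _ _ (hlin n) 1) => x; rewrite mul1r.
  have hnull x : (fun n => h n (T x)) @ \oo --> (0 : R).
    by apply: H => //; exists 1 => n z; rewrite mul1r.
  apply/cvgr0Pnorm_le => e e0.
  (* Limitedness upgrades the pointwise convergence of the functionals h_n o T to uniform
     convergence on [A], so it may be evaluated at the moving point a_n. *)
  have : \forall n \near \oo, forall b, A b -> `|h n (T b)| <= e.
    apply: (Alim (fun n z => h n (T z))) => // n; split.
      by move=> c y z; rewrite linearP (hlin n).
    move=> z; apply: continuous_comp; first exact: hT.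
    exact: (hdual n).2.
  apply: filterS => n /(_ _ (aP n).1); apply: le_trans.
  exact: le_trans (hu n) (ler_norm _).
Qed.
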